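(* For $i=1,2,3$ let $G_i$ be an $r_i$-regular graph with $n_i\ge1$ vertices and $m_i$ edges, with $r_1\ge 1$. Let $\theta_i$ ($1\le i\le n_1$), $\mu_j$ ($1\le j\le n_2$), $\eta_k$ ($1\le k\le n_3$) be the eigenvalues (with multiplicity) of $\mathcal L(G_1)$, $\mathcal L(G_2)$, $\mathcal L(G_3)$, respectively. Let $\mathcal G=G_1^S\bowtie(G_2^V\cup G_3^E)$ and $\mathfrak G=G_1^S\diamondsuit(G_2^V\cup G_3^E)$. Then, as identities of rational functions in $\lambda$: (i) $$\Phi_{\mathcal L(\mathcal G)}(\lambda)=\Big(\lambda-1-\tfrac{n_3}{(r_3+1)(2n_2+n_3+2)(\lambda-\frac1{r_3+1})}\Big)^{m_1-n_1}\prod_{j=1}^{n_2}\Big(\lambda-\tfrac{r_1+r_2\mu_j}{r_1+r_2}\Big)^{n_1}\prod_{k=1}^{n_3}\Big(\lambda-\tfrac{1+r_3\eta_k}{r_3+1}\Big)^{m_1}$$ $$\times\prod_{i=1}^{n_1}\Big((\lambda-1)\Big(\lambda-1-\tfrac{n_3}{(r_3+1)(2n_2+n_3+2)(\lambda-\frac{1}{r_3+1})}\Big)-\tfrac{(2-\theta_i)\left((r_1+r_2+n_2r_1)\lambda-(1+n_2)r_1\right)}{(r_1+r_2)(2n_2+n_3+2)(\lambda-\frac{r_1}{r_1+r_2})}\Big);$$ (ii) $$\Phi_{\mathcal L(\mathfrak G)}(\lambda)=(\lambda-1)^{m_1-n_1}\prod_{j=1}^{n_2}\Big(\lambda-\tfrac{2+r_2\mu_j}{r_2+2}\Big)^{m_1}\prod_{k=1}^{n_3}\Big(\lambda-\tfrac{1+r_3\eta_k}{r_3+1}\Big)^{n_1}$$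 $$\times\prod_{i=1}^{n_1}\Big((\lambda-1)\Big(\lambda-1-\tfrac{n_3}{(r_3+1)(r_1n_2+n_3+r_1)(\lambda-\frac1{r_3+1})}\Big)-\tfrac{r_1(2-\theta_i)\left((2n_2+r_2+2)\lambda-2n_2-2\right)}{2(r_2+2)(r_1n_2+n_3+r_1)(\lambda-\frac{2}{r_2+2})}\Big).$$
   Context: All graphs are finite, simple and undirected. The normalized Laplacian matrix of $G$ is $\mathcal L(G)=I-D(G)^{-1/2}A(G)D(G)^{-1/2}$, where $A(G)$ is the adjacency matrix and $D(G)$ the diagonal degree matrix; rows and columns of $\mathcal L(G)$ indexed by isolated vertices are taken to be zero (e.g. $\mathcal L(K_1)=(0)$). $\Phi_M(\lambda)=\det(\lambda I-M)$ is the characteristic polynomial of $M$. The subdivision graph $S(G_1)$ is obtained by inserting a new vertex into every edge of $G_1$; its vertex set is $V(G_1)\cup I(G_1)$, where $I(G_1)$ is the set of inserted vertices, in bijection with the edges of $G_1$. The graph $G_1^S\bowtie(G_2^V\cup G_3^E)$ (subdivision vertex-edge neighbourhood vertex-corona) consists of $S(G_1)$, $|V(G_1)|$ copies of $G_2$ and $|I(G_1)|$ copies of $G_3$, all vertex-disjoint, where for each $i$ every neighbour in $S(G_1)$ of the $i$-th vertex of $V(G_1)$ is joined to every vertex of the $i$-th copy of $G_2$, and for each $i$ the $i$-th vertex of $I(G_1)$ is joined to every vertex of the $i$-th copy of $G_3$. The graph $G_1^S\diamondsuit(G_2^V\cup G_3^E)$ (subdivision vertex-edge neighbourhood edge-corona)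 consists of $S(G_1)$, $|I(G_1)|$ copies of $G_2$ and $|V(G_1)|$ copies of $G_3$, all vertex-disjoint, where for each $i$ every neighbour in $S(G_1)$ of the $i$-th vertex of $I(G_1)$ is joined to every vertex of the $i$-th copy of $G_2$, and for each $i$ the $i$-th vertex of $V(G_1)$ is joined to every vertex of the $i$-th copy of $G_3$. *)

(* Defs.v *)
From HB Require Import structures.
From mathcomp Require Import all_boot all_order all_algebra.

Set Implicit Arguments.
Unset Strict Implicit.
Unset Printing Implicit Defensive.

Import Order.TTheory GRing.Theory Num.Theory.
Local Open Scope ring_scope.

Record sgraph := SGraph {
  vertex :> finType;
  adj : rel vertex;
  adj_sym : symmetric adj;
  adj_irr : irreflexive adj }.
Arguments adj {s} _ _ : rename.

Definition deg (G : sgraph) (x : G) : nat := #|[set y | adj x y]|.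

Definition regular (G : sgraph) (r : nat) : Prop := forall x : G, deg x = r.

Definition edges (G : sgraph) : {set {set G}} :=
  [set e : {set G} | [exists x, exists y, adj x y && (e == [set x; y])]].

Notation edge G := {e : {set G} | e \in edges G}.

Section Subdivision.
Variable G : sgraph.

Definition subdiv_adj : rel (G + edge G)%type := fun s t =>
  match s, t with
  | inl v, inr e => v \in val e
  | inr e, inl v => v \in val e
  | _, _ => false
  end.

Lemma subdiv_sym : symmetric subdiv_adj. Proof. by case=> [v|e] [w|f]. Qed.

Lemma subdiv_irr : irreflexive subdiv_adj. Proof. by case. Qed.

Definition subdivision : sgraph := SGraph subdiv_sym subdiv_irr.

End Subdivision.

(* S together with a copy of H for every j : J and a copy of K for every      *)
(* l : L: the j-th copy of H is fully joined to all the neighbours of a j in  *)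
(* S, and the l-th copy of K is fully joined to the single vertex b l.        *)
Section Corona.
Variables (S H K : sgraph) (J L : finType) (a : J -> S) (b : L -> S).

Definition corona_adj : rel (S + (J * H + L * K))%type := fun u v =>
  match u, v with
  | inl s, inl t => adj s t
  | inl s, inr (inl (j, _)) => adj (a j) s
  | inr (inl (j, _)), inl s => adj (a j) s
  | inl s, inr (inr (l, _)) => s == b l
  | inr (inr (l, _)), inl s => s == b l
  | inr (inl (j, x)), inr (inl (j', x')) => (j == j') && adj x x'
  | inr (inr (l, y)), inr (inr (l', y')) => (l == l') && adj y y'
  | _, _ => false
  end.

Lemma corona_sym : symmetric corona_adj.
Proof.
case=> [s|[[j x]|[l y]]] [t|[[j' x']|[l' y']]] //=; first exact: adj_sym.
  by rewrite eq_sym adj_sym.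
by rewrite eq_sym adj_sym.
Qed.

Lemma corona_irr : irreflexive corona_adj.
Proof. by case=> [s|[[j x]|[l y]]] /=; rewrite ?adj_irr ?andbF. Qed.

Definition corona : sgraph := SGraph corona_sym corona_irr.

End Corona.

Definition vertex_corona (G1 G2 G3 : sgraph) : sgraph :=
  @corona (subdivision G1) G2 G3 G1 (edge G1) inl inr.

Definition edge_corona (G1 G2 G3 : sgraph) : sgraph :=
  @corona (subdivision G1) G2 G3 (edge G1) G1 inr inl.

Section NormalizedLaplacian.
Variables (R : rcfType) (G : sgraph).

Definition adjmx : 'M[R]_#|G| :=
  \matrix_(i, j) (adj (enum_val i) (enum_val j))%:R.

(* The entry at an isolated vertex is junk (0^-1 = 0); normlap masks it. *)
Definition deg_invsqrt_mx : 'M[R]_#|G| :=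
  diag_mx (\row_i (Num.sqrt (deg (enum_val i))%:R)^-1).

Definition isolated (x : G) : bool := deg x == 0%N.

Definition normlap : 'M[R]_#|G| :=
  \matrix_(i, j)
    if isolated (enum_val i) || isolated (enum_val j) then 0
    else (1%:M - deg_invsqrt_mx *m adjmx *m deg_invsqrt_mx) i j.

End NormalizedLaplacian.

(* th lists the eigenvalues of M with (algebraic) multiplicity. *)
Definition eigenvalues_of (R : rcfType) (n d : nat) (M : 'M[R]_d)
    (th : 'I_n -> R) : Prop :=
  char_poly M = \prod_(i < n) ('X - (th i)%:P).

Notation ratfun R := {fraction {poly R}}.

Definition ratC (R : rcfType) (c : R) : ratfun R := tofrac c%:P.

Definition ratX (R : rcfType) : ratfun R := tofrac 'X.

(* Main.v *)
Require Import Defs.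
From mathcomp Require Import all_boot all_order all_algebra.
From mathcomp Require Import perm ring zify.
Import Order.TTheory GRing.Theory Num.Theory.
Local Open Scope ring_scope.

Set Implicit Arguments.
Unset Strict Implicit.
Unset Printing Implicit Defensive.

(** A graph without isolated vertices has the normalized Laplacian spectrum of
    the similar matrix I - D^-1 A, so its characteristic polynomial is
    det(zI + D^-1 A) with z = X - 1 ([char_poly_normlap]).  No square root is
    left, and the whole computation takes place over the field of rational
    functions.

    In both coronas each copy of G2 or G3 hangs on the subdivision graph
    through all its vertices at once, that is, through the all-ones vector.
    Regularity makes the all-ones vector an eigenvector of the diagonal block
    of a copy, so the Schur complement that eliminates all the copies needs no
    matrix inverse: it only involves the row sum of that block, which is a
    scalar p of the form X - c ([det_corona]).  The eliminated blocks contribute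
    the products over the eigenvalues mu and eta, by
    [det_walkmx_regular].

    What is left is a matrix on V(G1) + I(G1) whose off-diagonal blocks are
    scalar multiples of the vertex-edge incidence matrix N and of N^T.  One
    diagonal block is scalar, the other combines the identity with N^T N (for
    the vertex-corona) or N N^T (for the edge-corona).  A second Schur
    complement, together with Sylvester's identity in the first case, reduces
    it to a determinant det(bI - e N N^T); the difference between the two sizes
    is the source of the exponent m1 - n1.  Finally, for an
    r1-regular graph, N N^T = r1 I + A(G1) = r1 (2I - L(G1)), so this
    determinant is a product over the eigenvalues theta ([det_incidence]). *)

(** * Matrices indexed by finite types *)

Section FinMatrix.
Variable F : fieldType.

Definition fmx (I J : finType) (f : I -> J -> F) : 'M[F]_(#|I|, #|J|) :=
  \matrix_(i, j) f (enum_val i) (enum_val j).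

Lemma eq_fmx (I J : finType) (f g : I -> J -> F) : f =2 g -> fmx f = fmx g.
Proof. by move=> fg; apply/matrixP=> i j; rewrite !mxE fg. Qed.

Lemma fmxM (I J K : finType) (f : I -> J -> F) (g : J -> K -> F) :
  fmx f *m fmx g = fmx (fun i k => \sum_j f i j * g j k).
Proof.
apply/matrixP=> i k; rewrite !mxE [RHS](big_enum_val (A := J)) /=.
by apply: eq_bigr => j _; rewrite !mxE.
Qed.

Lemma fmx_scalar (I : finType) (c : F) :
  fmx (fun i j : I => c *+ (i == j)) = c%:M.
Proof. by apply/matrixP=> i j; rewrite !mxE (inj_eq enum_val_inj). Qed.

(** Both sides may have different, only provably equal, sizes; this is what
    allows index types to be replaced along arbitrary bijections. *)
Lemma det_mx_bij n n' (h : 'I_n' -> 'I_n) (M : 'M[F]_n) :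
  bijective h -> \det (\matrix_(i, j) M (h i) (h j)) = \det M.
Proof.
move=> bh; have En : n' = n by rewrite -(card_ord n') (bij_eq_card bh) card_ord.
case: _ / (esym En) h bh => h bh; pose s := perm (bij_inj bh).
have -> : \matrix_(i, j) M (h i) (h j) = row_perm s (col_perm s M).
  by apply/matrixP=> i j; rewrite !mxE !permE.
rewrite row_permE col_permE !det_mulmx !det_perm odd_permV mulrCA.
by rewrite -signr_addb addbb mulr1.
Qed.

Lemma det_fmx_ord n (I : finType) (e : 'I_n -> I) (f : I -> I -> F) :
  bijective e -> \det (fmx f) = \det (\matrix_(i, j) f (e i) (e j)).
Proof.
move=> be; rewrite -(@det_mx_bij _ _ (enum_rank \o e)).
  by congr (\det _); apply/matrixP=> i j; rewrite !mxE /= !enum_rankK.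
exact: bij_comp (@enum_rank_bij I) be.
Qed.

Lemma det_fmx_bij (I J : finType) (h : J -> I) (f : I -> I -> F) :
  bijective h -> \det (fmx f) = \det (fmx (fun i j => f (h i) (h j))).
Proof.
by move=> bh; rewrite (det_fmx_ord f (bij_comp bh (@enum_val_bij J))).
Qed.

Lemma det_fmx_sum (I J : finType) (f : I + J -> I + J -> F) :
  \det (fmx f) = \det (block_mx
    (fmx (fun i k => f (inl i) (inl k))) (fmx (fun i k => f (inl i) (inr k)))
    (fmx (fun i k => f (inr i) (inl k))) (fmx (fun i k => f (inr i) (inr k)))).
Proof.
pose e (k : 'I_(#|I| + #|J|)) : I + J := match split k with
  | inl i => inl (enum_val i) | inr j => inr (enum_val j) end.
have be : bijective e.
  pose e' (s : I + J) : 'I_(#|I| + #|J|) := unsplit (match s with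
    | inl i => inl (enum_rank i) | inr j => inr (enum_rank j) end).
  exists e'; rewrite /e /e' => k.
    by rewrite -[RHS]splitK; case: (split k) => i; rewrite enum_valK.
  by rewrite unsplitK; case: k => i; rewrite enum_rankK.
rewrite (det_fmx_ord _ be); congr (\det _); apply/matrixP=> i j.
by rewrite !mxE /e; case: (split i) => i'; rewrite !mxE; case: (split j) => j';
  rewrite !mxE.
Qed.

(** By induction on the number of blocks: transporting J to an ordinal, the
    index set 'I_n.+1 * H splits as H + 'I_n * H. *)
Lemma det_fmx_blockdiag (J H : finType) (f : H -> H -> F) :
  \det (fmx (fun u v : J * H => f u.2 v.2 *+ (u.1 == v.1)))
    = \det (fmx f) ^+ #|J|.
Proof.
have -> : \det (fmx (fun u v : J * H => f u.2 v.2 *+ (u.1 == v.1))) =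
  \det (fmx (fun u v : 'I_#|J| * H => f u.2 v.2 *+ (u.1 == v.1))).
  rewrite (@det_fmx_bij _ _ (fun u : 'I_#|J| * H => (enum_val u.1, u.2))).
    by congr (\det _); apply: eq_fmx => u v /=; rewrite (inj_eq enum_val_inj).
  exists (fun u => (enum_rank u.1, u.2)) => -[i x] /=.
    by rewrite enum_valK.
  by rewrite enum_rankK.
elim: #|J| => [|n IHn].
  by rewrite expr0 (@det_fmx_ord 0 _ (fun i => (i, ffun0 (card_ord 0) i)))
    ?det_mx00 //; apply: inj_card_bij => [[]|] //; rewrite card_prod card_ord.
pose h (s : H + 'I_n * H) : 'I_n.+1 * H :=
  match s with inl x => (ord0, x) | inr (i, x) => (lift ord0 i, x) end.
rewrite (@det_fmx_bij _ _ h).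
  rewrite det_fmx_sum /=.
  rewrite [X in block_mx _ X](_ : _ = 0) ?det_lblock.
    rewrite exprS -IHn; congr (_ * \det _).
    by apply: eq_fmx => -[i x] [j y] /=; rewrite (inj_eq lift_inj).
  apply/matrixP=> i j; rewrite !mxE /h.
  by case: (enum_val j) => k y /=.
apply: inj_card_bij; last by rewrite card_sum !card_prod !card_ord mulSn.
case=> [x|[i x]] [y|[j y]] //=; first by case=> ->.
by case=> /addnI/ord_inj-> ->.
Qed.

(** * Schur complements and Sylvester's identity *)

(** Asking for a solution X of D X = C instead of the inverse of D keeps D
    arbitrary, and in the applications X is explicit. *)
Lemma det_block_schur m n (A : 'M[F]_m) B C (D : 'M[F]_n) X :
  D *m X = C -> \det (block_mx A B C D) = \det (A - B *m X) * \det D.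
Proof.
move=> DX; rewrite -[LHS]mulr1.
have <- : \det (block_mx 1%:M 0 (- X) (1%:M : 'M[F]_n)) = 1.
  by rewrite det_lblock !det1 mulr1.
rewrite -det_mulmx mulmx_block !mulmx0 !mulmx1 !mulmxN DX subrr !add0r.
by rewrite det_ublock.
Qed.

Lemma det_block_schur_ul m n (A : 'M[F]_m) B C (D : 'M[F]_n) X :
  A *m X = B -> \det (block_mx A B C D) = \det A * \det (D - C *m X).
Proof.
move=> AX; rewrite -[LHS]mulr1.
have <- : \det (block_mx 1%:M (- X) 0 (1%:M : 'M[F]_n)) = 1.
  by rewrite det_ublock !det1 mulr1.
rewrite -det_mulmx mulmx_block !mulmx0 !mulmx1 !mulmxN AX addNr !addr0.
by rewrite det_lblock addrC.
Qed.

(** The two determinants are the two Schur complements of the block matrix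
    with rows (b I, N^T) and (c N, I). *)
Lemma det_sylvester m n (b c : F) (N : 'M[F]_(m, n)) : b != 0 ->
  \det (b%:M - c *: (N^T *m N)) =
    b ^ (n%:Z - m%:Z) * \det (b%:M - c *: (N *m N^T)).
Proof.
move=> b0.
have := @det_block_schur _ _ (b%:M) N^T (c *: N) 1%:M (c *: N) (mul1mx _).
rewrite (@det_block_schur_ul _ _ _ _ _ _ (b^-1 *: N^T)); last first.
  by rewrite mul_scalar_mx scalerA mulfV ?scale1r.
rewrite det1 mulr1 det_scalar -!scalemxAr -scalemxAl scalerA => <-.
have -> : b%:M - c *: (N *m N^T) = b *: (1%:M - (b^-1 * c) *: (N *m N^T)).
  by rewrite scalerBr scalemx1 scalerA mulrA mulfV ?mul1r.
by rewrite detZ expfzDr // -exprnN -exprnP -mulrA mulKf ?expf_neq0.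
Qed.

End FinMatrix.

(** * Edges, incidences and degrees *)

Lemma big_prod_type (A : Type) (idx : A) (op : Monoid.com_law idx)
    (I J : finType) (f : I * J -> A) :
  \big[op/idx]_p f p = \big[op/idx]_i \big[op/idx]_j f (i, j).
Proof. by rewrite pair_bigA; apply: eq_bigr => -[]. Qed.

Lemma deg_sum (G : sgraph) (x : G) : deg x = (\sum_y adj x y)%N.
Proof. by rewrite /deg -sum1dep_card big_mkcond. Qed.

(** The edges through v correspond bijectively to the neighbours of v. *)
Lemma sum_edges_at (A : nmodType) (G : sgraph) (v : G) (g : {set G} -> A) :
  \sum_(e : edge G) g (val e) *+ (v \in val e) =
    \sum_u g [set v; u] *+ adj v u.
Proof.
rewrite -(big_sub (mem (edges G)) (fun e : {set G} => g e *+ (v \in e))).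
have -> : \sum_(u : G) g [set v; u] *+ adj v u =
          \sum_(u in [set u | adj v u]) g [set v; u].
  rewrite [RHS]big_mkcond; apply: eq_bigr => u _.
  by rewrite inE; case: (adj v u).
rewrite -(big_imset (h := fun u => [set v; u])) /=; last first.
  move=> u w; rewrite !inE => vu vw /setP/(_ u); rewrite !inE eqxx orbT.
  by case: eqVneq vu => [->|_ _ /esym/eqP //]; rewrite adj_irr.
under eq_bigr do rewrite mulrb.
rewrite -big_mkcondr; apply: eq_bigl => e /=.
apply/andP/imsetP => [[]|[u]]; rewrite !inE.
  case/existsP=> x /existsP[y /andP[xy /eqP->]]; rewrite !inE.
  case/orP=> /eqP->; first by exists y; rewrite ?inE.
  by exists x; rewrite ?inE 1?adj_sym // setUC.
move=> vu ->; split; last by rewrite !inE eqxx.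
by apply/existsP; exists v; apply/existsP; exists u; rewrite vu eqxx.
Qed.

Lemma card_edge (G : sgraph) (e : edge G) : #|val e| = 2%N.
Proof.
have := valP e; rewrite inE => /existsP[x /existsP[y /andP[xy /eqP->]]].
by rewrite cards2; case: eqVneq xy => // ->; rewrite adj_irr.
Qed.

(** The entries of N N^T = D + A, for N the vertex-edge incidence matrix. *)
Lemma sum_incidence (G : sgraph) (v w : G) :
  (\sum_(e : edge G) (v \in val e) * (w \in val e) =
    (v == w) * deg v + adj v w)%N.
Proof.
under eq_bigr do rewrite mulnC mulnbr.
have := @sum_edges_at nat G v (fun e => (w \in e) : nat).
rewrite (eq_bigr (fun e : edge G =>
  if v \in val e then (w \in val e : nat) else 0%N)) => [->|e _]; last first.
  by rewrite mulrb.
case: eqVneq => [<-|wv].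
  rewrite mul1n adj_irr addn0 deg_sum; apply: eq_bigr => u _.
  by rewrite !inE eqxx mulrb; case: adj.
rewrite mul0n add0n (bigD1 w) //= !inE eqxx orbT big1 => [|u uw].
  by rewrite addr0 mulrb; case: adj.
by rewrite !inE eq_sym (negbTE wv) eq_sym (negbTE uw) mul0rn.
Qed.

Lemma deg_subdivision_inl (G : sgraph) (v : G) :
  @deg (subdivision G) (inl v) = deg v.
Proof.
have := sum_incidence v v; rewrite eqxx mul1n adj_irr addn0 => <-.
rewrite deg_sum big_sumType /= big1 // add0n.
by apply: eq_bigr => e _; case: (v \in _).
Qed.

Lemma deg_subdivision_inr (G : sgraph) (e : edge G) :
  @deg (subdivision G) (inr e) = 2%N.
Proof.
rewrite -(card_edge e) deg_sum big_sumType /= [X in (_ + X)%N]big1 // addn0.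
by rewrite -sum1_card [RHS]big_mkcond.
Qed.

Section CoronaDegree.
Variables (S H K : sgraph) (J L : finType) (a : J -> S) (b : L -> S).
Let C := corona H K a b.

Lemma deg_corona_base (s : S) : @deg C (inl s) =
  (deg s + #|H| * \sum_j adj (a j) s + #|K| * \sum_l (s == b l))%N.
Proof.
rewrite deg_sum big_sumType big_sumType /= addnA -deg_sum; congr (_ + _ + _)%N.
  rewrite big_distrr big_prod_type /=.
  by apply: eq_bigr => j _; rewrite sum_nat_const.
rewrite big_distrr big_prod_type /=.
by apply: eq_bigr => j _; rewrite sum_nat_const.
Qed.

Lemma deg_corona_left j (x : H) :
  @deg C (inr (inl (j, x))) = (deg (a j) + deg x)%N.
Proof.
rewrite !deg_sum big_sumType big_sumType /=; congr (_ + _)%N.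
rewrite [X in (_ + X)%N]big1 // addn0.
rewrite big_prod_type /=.
rewrite (bigD1 j) //= [X in (_ + X)%N]big1 => [|i /negbTE ij].
  by rewrite eqxx addn0.
by rewrite big1 // => y _; rewrite eq_sym ij.
Qed.

Lemma deg_corona_right l (y : K) : @deg C (inr (inr (l, y))) = (deg y).+1.
Proof.
rewrite !deg_sum big_sumType big_sumType /= [X in (_ + (X + _))%N]big1 //.
rewrite add0n -add1n; congr (_ + _)%N.
  by rewrite (bigD1 (b l)) //= eqxx big1 // => s /negbTE->.
rewrite big_prod_type /=.
rewrite (bigD1 l) //= [X in (_ + X)%N]big1 => [|i /negbTE il].
  by rewrite eqxx addn0.
by rewrite big1 // => x _; rewrite eq_sym il.
Qed.

End CoronaDegree.

(** * Elimination of the copies in a corona *)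

(** The entries of z I + D^-1 A, for an arbitrary weight d in place of the
    degree: the graphs that are glued into a corona keep their adjacency but
    have the degrees of the corona. *)
Definition walkmx (F : fieldType) (G : sgraph) (z : F) (d : G -> F)
    (u v : G) : F :=
  z *+ (u == v) + (adj u v)%:R / d u.

Section CoronaDet.
Variables (F : fieldType) (S H K : sgraph) (J L : finType).
Variables (a : J -> S) (b : L -> S) (z : F) (d : corona H K a b -> F).
Variables (rH rK : nat) (h k : F).
Hypotheses (regH : regular H rH) (regK : regular K rK).
Hypothesis dH : forall u, d (inr (inl u)) = h.
Hypothesis dK : forall u, d (inr (inr u)) = k.
Let pH := z + rH%:R / h.
Let pK := z + rK%:R / k.
Hypotheses (pH0 : pH != 0) (pK0 : pK != 0).

Lemma walkmx_row_sum (G : sgraph) r (c : F) (x : G) : regular G r ->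
  \sum_y walkmx z (fun _ => c) x y = z + r%:R / c.
Proof.
move=> regG; rewrite big_split /= -mulr_suml -natr_sum -deg_sum regG.
congr (_ + _); rewrite (bigD1 x) //= eqxx big1 ?addr0 // => y.
by rewrite eq_sym => /negbTE->.
Qed.

(** Eliminates all the copies of H and K.  The j-th copy of H touches the base
    through a block whose rows all equal the neighbourhood of a j, scaled, and
    its diagonal block has constant row sum pH, so dividing that neighbourhood
    by h pH solves the linear system of the Schur complement; likewise for
    K. *)
Lemma det_corona :
  \det (fmx (walkmx z d)) =
  \det (fmx (fun s t : S => walkmx z (d \o inl) s t
     - (#|H|%:R / (h * pH) * (\sum_j adj (a j) s * adj (a j) t)%N%:R
        + #|K|%:R / (k * pK) * (\sum_l (s == b l) * (t == b l))%N%:R)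
       / d (inl s)))
  * (\det (fmx (walkmx z (fun _ : H => h))) ^+ #|J|
     * \det (fmx (walkmx z (fun _ : K => k))) ^+ #|L|).
Proof.
rewrite det_fmx_sum.
pose X (u : J * H + L * K) (t : S) : F := match u with
  | inl (j, _) => (adj (a j) t)%:R / (h * pH)
  | inr (l, _) => (t == b l)%:R / (k * pK) end.
rewrite (@det_block_schur _ _ _ _ _ _ _ (fmx X)); last first.
  rewrite fmxM; apply: eq_fmx => u t; rewrite big_sumType /=.
  case: u => [[j x]|[l y]]; rewrite /walkmx /X.
    rewrite [X in _ + X]big1 => [|[l y] _]; last by rewrite mul0r addr0 mul0r.
    rewrite addr0 big_prod_type (bigD1 j) //=.
    rewrite [X in _ + X]big1 => [|i /negbTE ij]; last first.
      rewrite big1 // => y _.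
      rewrite -[inr _ == _]/((j, x) == (i, y)) xpair_eqE eq_sym ij.
      by rewrite mul0r addr0 mul0r.
    rewrite addr0 -mulr_suml.
    rewrite (eq_bigr (walkmx z (fun _ : H => h) x)) => [|y _]; last first.
      rewrite -[inr _ == _]/((j, x) == (j, y)) xpair_eqE eqxx /=.
      by rewrite dH.
    rewrite (walkmx_row_sum _ _ regH) -/pH dH mulr0n add0r invfM.
    by rewrite mulrC -mulrA mulfVK.
  rewrite [X in X + _]big1 => [|[j x] _]; last by rewrite mul0r addr0 mul0r.
  rewrite add0r big_prod_type (bigD1 l) //=.
  rewrite [X in _ + X]big1 => [|i /negbTE il]; last first.
    rewrite big1 // => x _.
    rewrite -[inr _ == _]/((l, y) == (i, x)) xpair_eqE eq_sym il.
    by rewrite mul0r addr0 mul0r.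
  rewrite addr0 -mulr_suml.
  rewrite (eq_bigr (walkmx z (fun _ : K => k) y)) => [|x _]; last first.
    rewrite -[inr _ == _]/((l, y) == (l, x)) xpair_eqE eqxx /=.
    by rewrite dK.
  rewrite (walkmx_row_sum _ _ regK) -/pK dK mulr0n add0r invfM.
  by rewrite mulrC -mulrA mulfVK.
congr (_ * _).
  rewrite fmxM; congr (\det _); apply/matrixP => i j; rewrite !mxE.
  set s := enum_val i; set t := enum_val j.
  congr (_ - _); rewrite big_sumType /= mulrDl; congr (_ + _).
    rewrite big_prod_type /= natr_sum mulr_sumr mulr_suml.
    apply: eq_bigr => l _.
    rewrite /walkmx /= mulr0n add0r sumr_const natrM -mulr_natl.
    by rewrite -[#|_|%:R]/(#|H|%:R); ring.
  rewrite big_prod_type /= natr_sum mulr_sumr mulr_suml; apply: eq_bigr => l _.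
  rewrite /walkmx /= mulr0n add0r sumr_const natrM -mulr_natl.
  by rewrite -[#|_|%:R]/(#|K|%:R); ring.
rewrite det_fmx_sum [X in block_mx _ X](_ : _ = 0); last first.
  apply/matrixP=> i j; rewrite !mxE.
  case: (enum_val i) => ? ?; case: (enum_val j) => ? ?.
  by rewrite /walkmx /= mul0r addr0.
rewrite det_lblock -!det_fmx_blockdiag.
congr (_ * _); congr (\det _); apply: eq_fmx => -[i x] [j y];
  rewrite /walkmx ?dH ?dK.
  rewrite -[inr _ == _]/((i, x) == (j, y)) xpair_eqE /=.
  by case: eqP => //=; rewrite mul0r addr0.
rewrite -[inr _ == _]/((i, x) == (j, y)) xpair_eqE /=.
by case: eqP => //=; rewrite mul0r addr0.
Qed.

End CoronaDet.

(** * Determinants and normalized Laplacian eigenvalues *)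

(** For e nonzero this is the characteristic polynomial evaluated at c / e,
    up to the factor e ^+ n; the case e = 0 has to be included because the
    regularity degree of a graph may vanish. *)
Lemma det_eigenvalues (R : rcfType) (F : fieldType) (f : {rmorphism R -> F})
    n d (M : 'M[R]_d) (th : 'I_n -> R) (c e : F) : eigenvalues_of M th ->
  \det (c%:M - e *: map_mx f M) = \prod_(i < n) (c - e * f (th i)).
Proof.
move=> Mth; have En : d = n.
  have := size_char_poly M; rewrite Mth size_prod_XsubC => -[<-].
  by rewrite /index_enum -enumT size_enum_ord.
have [->|e0] := eqVneq e 0.
  rewrite scale0r subr0 det_scalar En.
  under eq_bigr do rewrite mul0r subr0.
  by rewrite prodr_const card_ord.
have -> : c%:M - e *: map_mx f M = e *: ((c / e)%:M - map_mx f M).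
  by rewrite scalerBr scale_scalar_mx mulrCA mulfV ?mulr1.
rewrite detZ.
have -> : \det ((c / e)%:M - map_mx f M) = (char_poly (map_mx f M)).[c / e].
  rewrite /char_poly -horner_evalE -det_map_mx; congr (\det _).
  apply/matrixP=> i j; rewrite !mxE /= horner_evalE.
  by rewrite !hornerE hornerMn hornerX.
rewrite -map_char_poly Mth map_prod_XsubC horner_prod En -{1}(card_ord n).
rewrite -prodr_const -big_split; apply: eq_bigr => i _ /=.
by rewrite hornerXsubC mulrBr mulrCA mulfV ?mulr1.
Qed.

(** An entry of the conjugate of y I + D^(-1/2) A D^(-1/2) by D^(1/2): p and q
    stand for the square roots of the degrees, c for the entry of A, and e for
    equality of the indices. *)
Lemma conj_entry (F : fieldType) (p q y c : F) (e : bool) :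
    p != 0 -> q != 0 -> (e -> p = q) ->
  p^-1 * (y *+ e + c / (p * q)) * q = y *+ e + c / p ^+ 2.
Proof.
move=> p0 q0; case: e => [->//|_]; first by rewrite !mulr1n; field; rewrite q0.
by rewrite !mulr0n; field; rewrite p0 q0.
Qed.

Section Spectrum.
Variable R : rcfType.

Definition ratC_morph : {rmorphism R -> ratfun R} :=
  @FracField.tofrac {poly R} \o polyC.

Lemma ratCE c : ratC c = ratC_morph c. Proof. by []. Qed.

Lemma natF_neq0 n : (0 < n)%N -> n%:R != 0 :> ratfun R.
Proof.
by move=> n0; rewrite -(rmorph_nat ratC_morph) fmorph_eq0 pnatr_eq0 -lt0n.
Qed.

Lemma det_conj_diag (F : fieldType) n (u v : 'I_n -> F) (M : 'M[F]_n) :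
  (forall i, u i * v i = 1) ->
  \det (\matrix_(i, j) (u i * M i j * v j)) = \det M.
Proof.
move=> uv.
have -> : \matrix_(i, j) (u i * M i j * v j) =
    diag_mx (\row_i u i) *m M *m diag_mx (\row_i v i).
  by apply/matrixP=> i j; rewrite mul_diag_mx mul_mx_diag !mxE.
rewrite !det_mulmx !det_diag mulrAC -big_split big1 /= ?mul1r // => i _.
by rewrite !mxE uv.
Qed.

Lemma normlapE (G : sgraph) (i j : 'I_#|G|) :
    (0 < deg (enum_val i))%N -> (0 < deg (enum_val j))%N ->
  normlap R G i j = (i == j)%:R - (Num.sqrt (deg (enum_val i))%:R)^-1
    * (adj (enum_val i) (enum_val j))%:R * (Num.sqrt (deg (enum_val j))%:R)^-1.
Proof.
move=> di dj; rewrite mxE /isolated !gtn_eqF //= mxE mxE [X in _ + X]mxE.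
congr (_ - _).
by rewrite mul_mx_diag mul_diag_mx !mxE.
Qed.

(** Conjugation by D^(1/2) turns L into I - D^-1 A. *)
Lemma char_poly_normlap (G : sgraph) : (forall u : G, 0 < deg u)%N ->
  tofrac (char_poly (normlap R G)) =
    \det (fmx (walkmx (ratX R - 1) (fun u : G => (deg u)%:R))).
Proof.
move=> deg_gt0.
pose s (u : G) : R := Num.sqrt (deg u)%:R.
have s0 u : s u != 0 by rewrite sqrtr_eq0 -ltNge ltr0n.
have ss u : s u ^+ 2 = (deg u)%:R by rewrite sqr_sqrtr ?ler0n.
rewrite /char_poly -det_map_mx.
rewrite -(@det_conj_diag _ _ (fun i => ratC_morph (s (enum_val i))^-1)
  (fun i => ratC_morph (s (enum_val i)))); last first.
  by move=> i; rewrite -rmorphM mulVf ?rmorph1.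
congr (\det _); apply/matrixP=> i j.
rewrite mxE [X in _ * X * _]mxE [RHS]mxE /walkmx.
have -> : char_poly_mx (normlap R G) i j =
    'X *+ (i == j) - (normlap R G i j)%:P by rewrite !mxE.
rewrite normlapE //.
rewrite (inj_eq enum_val_inj) -/(s _) -/(s _).
set u := enum_val i; set v := enum_val j.
rewrite -(rmorph_nat ratC_morph (deg u)) -ss.
transitivity (ratC_morph (s u)^-1 * ((ratX R - 1) *+ (i == j)
    + (adj u v)%:R / (ratC_morph (s u) * ratC_morph (s v))) * ratC_morph (s v)).
  congr (_ * _ * _); rewrite rmorphB -[X in _ - X]/(ratC_morph _).
  rewrite rmorphB !rmorphM !rmorph_nat !fmorphV rmorphMn.
  rewrite -[X in X *+ _ - _]/(ratX R).
  rewrite mulrnBl opprB addrA addrAC; congr (_ + _).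
  by rewrite invfM mulrA [_^-1 * _]mulrC.
rewrite rmorphXn fmorphV; apply: conj_entry; rewrite ?fmorph_eq0 //.
by move=> /eqP Eij; rewrite /u Eij.
Qed.

(** Also for r = 0: both sides then vanish, whatever the masked entries of the
    normalized Laplacian are. *)
Lemma fmx_adj_regular (G : sgraph) r : regular G r ->
  fmx (fun u v : G => (adj u v)%:R) =
    r%:R *: (1%:M - map_mx ratC_morph (normlap R G)).
Proof.
move=> regG; apply/matrixP => i j; rewrite mxE.
have -> : (r%:R *: (1%:M - map_mx ratC_morph (normlap R G))) i j =
    r%:R * ((i == j)%:R - ratC_morph (normlap R G i j)) by rewrite !mxE.
case: (posnP r) => [r0|r0].
  have := regG (enum_val i); rewrite /deg r0 => /eqP; rewrite cards_eq0.
  by move=> /eqP/setP/(_ (enum_val j)); rewrite !inE => ->; rewrite mul0r.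
rewrite normlapE ?regG // rmorphB rmorph_nat opprB addrC subrK.
rewrite mulrAC -invfM -expr2 sqr_sqrtr ?ler0n // rmorphM fmorphV !rmorph_nat.
by rewrite mulVKf ?natF_neq0.
Qed.

Lemma det_walkmx_regular (G : sgraph) n r (z h : ratfun R) (th : 'I_n -> R) :
  regular G r -> eigenvalues_of (normlap R G) th ->
  \det (fmx (walkmx z (fun _ : G => h))) =
    \prod_(i < n) (z + r%:R / h - r%:R / h * ratC (th i)).
Proof.
move=> regG Gth; rewrite -(det_eigenvalues ratC_morph _ _ Gth); congr (\det _).
have -> : fmx (walkmx z (fun _ : G => h)) =
   z%:M + h^-1 *: fmx (fun u v : G => (adj u v)%:R).
  by rewrite -fmx_scalar; apply/matrixP=> i j; rewrite !mxE mulrC.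
rewrite (fmx_adj_regular regG) scalerA mulrC scalerBr scalemx1 addrA.
by rewrite raddfD.
Qed.

Definition incmx (F : fieldType) (G : sgraph) :=
  fmx (fun (v : G) (e : edge G) => (v \in val e)%:R : F).

Lemma det_incidence (G : sgraph) n r (c e : ratfun R) (th : 'I_n -> R) :
  regular G r -> eigenvalues_of (normlap R G) th ->
  \det (c%:M - e *: (incmx (ratfun R) G *m (incmx (ratfun R) G)^T)) =
    \prod_(i < n) (c - e * (r%:R * (2 - ratC (th i)))).
Proof.
move=> regG Gth.
have -> : incmx (ratfun R) G *m (incmx (ratfun R) G)^T =
    r%:R%:M + fmx (fun u v : G => (adj u v)%:R).
  have -> : (incmx (ratfun R) G)^T =
      fmx (fun (e : edge G) (v : G) => (v \in val e)%:R).
    by apply/matrixP=> i j; rewrite !mxE.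
  rewrite fmxM -fmx_scalar; apply/matrixP=> i j; rewrite !mxE.
  under eq_bigr do rewrite -natrM.
  by rewrite -natr_sum sum_incidence natrD regG natrM mulr_natl.
rewrite (fmx_adj_regular regG).
have -> : c%:M
    - e *: (r%:R%:M + r%:R *: (1%:M - map_mx ratC_morph (normlap R G))) =
  (c - e * r%:R * 2)%:M - (- (e * r%:R)) *: map_mx ratC_morph (normlap R G).
  by apply/matrixP=> i j; move: (map_mx _ _) => M; rewrite !mxE; ring.
rewrite (det_eigenvalues ratC_morph _ _ Gth); apply: eq_bigr => i _.
by rewrite ratCE; ring.
Qed.

End Spectrum.

(** * Block determinants built on an incidence matrix *)

(** Eliminating the scalar block z I adds a multiple of N^T N to the other
    diagonal block; [det_sylvester] then exchanges N^T N for N N^T. *)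
Lemma det_block_incidence_dr (F : fieldType) n m (N : 'M[F]_(n, m))
    (z a c b g : F) :
  z != 0 -> b != 0 ->
  \det (block_mx z%:M (a *: N) (c *: N^T) (b%:M - g *: (N^T *m N))) =
    b ^ (m%:Z - n%:Z) * (z ^+ n * \det (b%:M - (g + a * c / z) *: (N *m N^T))).
Proof.
move=> z0 b0; rewrite (@det_block_schur_ul _ _ _ _ _ _ _ ((a / z) *: N)).
  rewrite det_scalar mulrCA -det_sylvester //; congr (_ * \det _).
  rewrite -scalemxAl -scalemxAr scalerA -addrA -opprD -scalerDl.
  by rewrite mulrA [c * a]mulrC.
by rewrite mul_scalar_mx scalerA mulrC mulfVK.
Qed.

Lemma det_block_incidence_ul (F : fieldType) n m (N : 'M[F]_(n, m))
    (z a c b g : F) :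
  z != 0 ->
  \det (block_mx (b%:M - g *: (N *m N^T)) (a *: N) (c *: N^T) z%:M) =
    z ^ (m%:Z - n%:Z) * (z ^+ n * \det (b%:M - (g + a * c / z) *: (N *m N^T))).
Proof.
move=> z0; rewrite (@det_block_schur _ _ _ _ _ _ _ ((c / z) *: N^T)).
  rewrite det_scalar [RHS]mulrA [z ^+ n]exprnP -expfzDr // subrK mulrC.
  congr (_ * \det _).
  rewrite -scalemxAl -scalemxAr scalerA -addrA -opprD -scalerDl.
  by rewrite mulrA.
by rewrite mul_scalar_mx scalerA mulrC mulfVK.
Qed.

(** * Scalar factors *)

Section Factors.
Variable F : fieldType.
Implicit Types x p q z t b n r d h : F.

(** Row sum of the diagonal block of a copy of a q-regular graph whose vertices
    have p further neighbours, hence degree h, in the corona. *)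
Lemma copy_pole x (p q h : F) :
  h = p + q -> h != 0 -> x - 1 + q / h = x - p / h.
Proof. by move=> -> h0; field. Qed.

Lemma copy_factor x (p q h t : F) : h = p + q -> h != 0 ->
  x - 1 + q / h - q / h * t = x - (p + q * t) / h.
Proof. by move=> -> h0; field. Qed.

(** One factor of z ^+ n det(b I - e N N^T), with the value of e that
    [det_block_incidence_dr] produces.  The linear polynomial on the right is
    rewritten through the pole p of the copies, after which x occurs in
    denominators only through p and x - 1. *)
Lemma vertex_corona_factor x b n2 d t (r1 r2 : F) :
  r1 + r2 != 0 -> r1 != 0 -> d != 0 -> x - 1 != 0 -> x - r1 / (r1 + r2) != 0 ->
  (x - 1) * (b - (n2 / ((r1 + r2) * (x - r1 / (r1 + r2))) / d
                  + r1^-1 * d^-1 / (x - 1)) * (r1 * (2 - t)))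
  = (x - 1) * b - ((2 - t) * ((r1 + r2 + n2 * r1) * x - (1 + n2) * r1))
       / ((r1 + r2) * d * (x - r1 / (r1 + r2))).
Proof.
move=> h0 r0 d0 z0; set p := x - _ => p0.
have -> : (r1 + r2 + n2 * r1) * x - (1 + n2) * r1 =
    (x - 1) * r1 * n2 + (r1 + r2) * p by rewrite /p; field.
by field; rewrite d0 p0 h0 r0 z0.
Qed.

Lemma edge_corona_factor x b n2 d t (r1 r2 : F) :
  r2 + 2 != 0 -> 2 != 0 :> F -> d != 0 -> x - 1 != 0 -> x - 2 / (r2 + 2) != 0 ->
  (x - 1) * (b - (n2 / ((r2 + 2) * (x - 2 / (r2 + 2))) / d
                  + d^-1 * 2^-1 / (x - 1)) * (r1 * (2 - t)))
  = (x - 1) * b - (r1 * (2 - t) * ((2 * n2 + r2 + 2) * x - 2 * n2 - 2))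
       / (2 * (r2 + 2) * d * (x - 2 / (r2 + 2))).
Proof.
move=> h0 two0 d0 z0; set p := x - _ => p0.
have -> : (2 * n2 + r2 + 2) * x - 2 * n2 - 2 =
    2 * ((x - 1) * n2) + (r2 + 2) * p by rewrite /p; field.
by field; rewrite d0 p0 h0 two0 z0.
Qed.

End Factors.

(** * Nonvanishing of the rational functions that are inverted *)

Lemma ratX_sub_neq0 (R : rcfType) (c : R) : ratX R - ratC_morph R c != 0.
Proof. by rewrite -rmorphB tofrac_eq0 polyXsubC_eq0. Qed.

(** Otherwise (X - 1) (X - 1/k) would be a nonzero constant, although it
    vanishes at 1.  This makes negative powers, which occur for m1 < n1,
    legitimate. *)
Lemma pole_perturbation_neq0 (R : rcfType) (n k d : nat) :
    (0 < n)%N -> (0 < k)%N -> (0 < d)%N ->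
  ratX R - 1 - n%:R / (k%:R * d%:R * (ratX R - 1 / k%:R)) != 0.
Proof.
move=> n0 k0 d0; pose e : R := n%:R / (k * d)%N%:R.
have e0 : e != 0 by rewrite mulf_neq0 ?invr_eq0 ?pnatr_eq0 -?lt0n ?muln_gt0 ?k0.
have -> : 1 / k%:R = ratC_morph R k%:R^-1 by rewrite fmorphV rmorph_nat div1r.
have -> : n%:R / (k%:R * d%:R * (ratX R - ratC_morph R k%:R^-1)) =
    ratC_morph R e / (ratX R - ratC_morph R k%:R^-1).
  by rewrite /e fmorph_div !rmorph_nat natrM invfM mulrA.
apply: contra_neq e0 => /eqP; rewrite subr_eq0 => /eqP Ee.
have : (ratX R - 1) * (ratX R - ratC_morph R k%:R^-1) = ratC_morph R e.
  by rewrite Ee mulfVK ?ratX_sub_neq0.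
rewrite -(rmorph1 (ratC_morph R)) -!rmorphB -rmorphM => /eqP.
rewrite tofrac_eq => /eqP/(congr1 (fun p => p.[1])).
by rewrite hornerM !hornerXsubC subrr mul0r hornerC.
Qed.

(** * The two coronas *)

Lemma divf_mulAC (F : fieldType) (n k p d : F) :
  n / (k * p) / d = n / (k * d * p).
Proof. by rewrite -mulrA -invfM [k * p * d]mulrAC. Qed.

Section TwoCoronas.
Variables (R : rcfType) (G1 G2 G3 : sgraph) (r1 r2 r3 : nat).
Hypotheses (reg1 : regular G1 r1) (reg2 : regular G2 r2) (reg3 : regular G3 r3).
Hypotheses (r1_gt0 : (0 < r1)%N).
Let VC := vertex_corona G1 G2 G3.
Let EC := edge_corona G1 G2 G3.

Lemma deg_vertex_corona (u : VC) : deg u = match u with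
  | inl (inl _) => r1
  | inl (inr _) => (2 * #|G2| + #|G3| + 2)%N
  | inr (inl _) => (r1 + r2)%N
  | inr (inr _) => r3.+1
  end.
Proof.
case: u => [[v|e]|[[v x]|[e y]]].
- rewrite deg_corona_base deg_subdivision_inl reg1 !big1 ?muln0 ?addn0 //.
- rewrite deg_corona_base deg_subdivision_inr /=.
  rewrite (eq_bigr (fun v => if v \in val e then 1 else 0)%N); last first.
    by move=> v _; case: (v \in _).
  rewrite -big_mkcond sum1_card card_edge (bigD1 e) //= eqxx big1; first lia.
  move=> f /negbTE fe.
  by rewrite -[inr e == inr f]/(e == f) eq_sym fe.
- by rewrite deg_corona_left deg_subdivision_inl reg1 reg2.
- by rewrite deg_corona_right reg3.
Qed.

Lemma deg_edge_corona (u : EC) : deg u = match u with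
  | inl (inl _) => (r1 * #|G2| + #|G3| + r1)%N
  | inl (inr _) => 2
  | inr (inl _) => (r2 + 2)%N
  | inr (inr _) => r3.+1
  end.
Proof.
case: u => [[v|e]|[[e x]|[v y]]].
- rewrite deg_corona_base deg_subdivision_inl reg1 /=.
  have -> : (\sum_(e : edge G1) (v \in val e) = r1)%N.
    rewrite -(reg1 v) -deg_subdivision_inl deg_sum big_sumType /=.
    by rewrite [X in (X + _)%N]big1.
  rewrite (bigD1 v) //= eqxx big1 => [|w /negbTE vw]; first lia.
  by rewrite -[inl v == inl w]/(v == w) eq_sym vw.
- rewrite deg_corona_base deg_subdivision_inr !big1 ?muln0 ?addn0 //.
- by rewrite deg_corona_left deg_subdivision_inr reg2 addnC.
- by rewrite deg_corona_right reg3.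
Qed.

Section SchurComplement.
Variable F : fieldType.
Let N := incmx F G1.
Variables z b p q : F.

Let inl_eqE (I J : eqType) (i i' : I) : (inl i == inl i' :> I + J) = (i == i').
Proof. by []. Qed.

Let inr_eqE (I J : eqType) (j j' : J) : (inr j == inr j' :> I + J) = (j == j').
Proof. by []. Qed.

Let sum_eqb (I : finType) (i i' : I) :
  (\sum_(l : I) (i == l) * (i' == l) = (i == i'))%N.
Proof.
rewrite (bigD1 i) //= eqxx mul1n big1 => [|l /negbTE li].
  by rewrite addn0 eq_sym.
by rewrite eq_sym li.
Qed.

Let natr_sumM (I : finType) (f g : I -> nat) :
  (\sum_i f i * g i)%N%:R = \sum_i (f i)%:R * (g i)%:R :> F.
Proof. by rewrite natr_sum; apply: eq_bigr => i _; rewrite natrM. Qed.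

Lemma tr_incmx : N^T = fmx (fun (e : edge G1) (v : G1) => (v \in val e)%:R).
Proof. by apply/matrixP=> i j; rewrite !mxE. Qed.

(** The Schur complement left by [det_corona] on V(G1) + I(G1).  Copies of G2
    sit on neighbourhoods of vertices, so they only change the I(G1) block, by
    a multiple of N^T N, and so do the copies of G3, by a scalar. *)
Lemma det_schur_vertex_corona (d := (2 * #|G2| + #|G3| + 2)%N) :
  z != 0 -> b != 0 -> z - q / d%:R = b ->
  \det (fmx (fun s t : subdivision G1 =>
      walkmx z ((fun u : VC => (deg u)%:R) \o inl) s t
      - (p * (\sum_(j : G1) adj (inl j : subdivision G1) s
                * adj (inl j : subdivision G1) t)%N%:R
         + q * (\sum_(l : edge G1) (s == inr l) * (t == inr l))%N%:R)
        / (deg (inl s : VC))%:R)) =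
  b ^ (#|edges G1|%:Z - #|G1|%:Z) * (z ^+ #|G1| *
    \det (b%:M - (p / d%:R + r1%:R^-1 * d%:R^-1 / z) *: (N *m N^T))).
Proof.
move=> z0 b0 bE; rewrite det_fmx_sum.
rewrite -(card_sig (mem (edges G1))) -det_block_incidence_dr //.
congr (\det _); congr block_mx.
- rewrite -fmx_scalar; apply: eq_fmx => v w; rewrite /walkmx /= inl_eqE.
  by rewrite !big1 // !mulr0 !addr0 !mul0r subr0 addr0.
- apply/matrixP => i j; rewrite !mxE /walkmx /= !big1 //.
  rewrite !mulr0 addr0 mul0r subr0 deg_vertex_corona /= mulr0n add0r.
  by rewrite mulrC.
- apply/matrixP => i j; rewrite !mxE /walkmx /= !big1; last 2 first.
  + by move=> e _; rewrite muln0.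
  + by move=> e _; rewrite muln0.
  rewrite !mulr0 addr0 mul0r subr0 deg_vertex_corona /= mulr0n add0r.
  by rewrite mulrC.
rewrite tr_incmx fmxM -fmx_scalar; apply/matrixP => i j; rewrite !mxE.
rewrite deg_vertex_corona /walkmx /=.
set e := enum_val i; set f := enum_val j.
have -> : (\sum_(l : edge G1) (inr e == inr l :> subdivision G1)
    * (inr f == inr l :> subdivision G1) = (e == f))%N by exact: sum_eqb.
rewrite inr_eqE mul0r addr0 -bE natr_sumM /=.
rewrite -/d mulrnBl -[(q / _) *+ _]mulr_natr; ring.
Qed.

(** Here all the copies change the V(G1) block, the copies of G2 by a multiple
    of N N^T, and I(G1) keeps the scalar block z I. *)
Lemma det_schur_edge_corona (d := (r1 * #|G2| + #|G3| + r1)%N) :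
  z != 0 -> z - q / d%:R = b ->
  \det (fmx (fun s t : subdivision G1 =>
      walkmx z ((fun u : EC => (deg u)%:R) \o inl) s t
      - (p * (\sum_(j : edge G1) adj (inr j : subdivision G1) s
                * adj (inr j : subdivision G1) t)%N%:R
         + q * (\sum_(l : G1) (s == inl l) * (t == inl l))%N%:R)
        / (deg (inl s : EC))%:R)) =
  z ^ (#|edges G1|%:Z - #|G1|%:Z) * (z ^+ #|G1| *
    \det (b%:M - (p / d%:R + d%:R^-1 * 2^-1 / z) *: (N *m N^T))).
Proof.
move=> z0 bE; rewrite det_fmx_sum.
rewrite -(card_sig (mem (edges G1))) -det_block_incidence_ul //.
congr (\det _); congr block_mx.
- rewrite tr_incmx fmxM -fmx_scalar; apply/matrixP => i j; rewrite !mxE.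
  rewrite deg_edge_corona /walkmx /=.
  set e := enum_val i; set f := enum_val j.
  have -> : (\sum_(l : G1) (inl e == inl l :> subdivision G1)
      * (inl f == inl l :> subdivision G1) = (e == f))%N by exact: sum_eqb.
  rewrite inl_eqE mul0r addr0 -bE natr_sumM /=.
  rewrite -/d mulrnBl -[(q / _) *+ _]mulr_natr; ring.
- apply/matrixP => i j; rewrite !mxE /walkmx /= !big1; last 2 first.
  + by move=> e _; rewrite muln0.
  + by move=> e _; rewrite muln0.
  rewrite !mulr0 addr0 mul0r subr0 deg_edge_corona /= mulr0n add0r.
  by rewrite mulrC.
- apply/matrixP => i j; rewrite !mxE /walkmx /= !big1 //.
  rewrite !mulr0 addr0 mul0r subr0 deg_edge_corona /= mulr0n add0r.
  by rewrite mulrC.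
rewrite -fmx_scalar; apply: eq_fmx => v w; rewrite /walkmx /= inr_eqE.
by rewrite !big1 // !mulr0 !addr0 !mul0r subr0 addr0.
Qed.

End SchurComplement.

Variables (n1 n2 n3 : nat).
Variables (theta : 'I_n1 -> R) (mu : 'I_n2 -> R) (eta : 'I_n3 -> R).
Hypotheses (hn1 : #|G1| = n1) (hn2 : #|G2| = n2) (hn3 : #|G3| = n3).
Hypothesis n3_gt0 : (0 < n3)%N.
Hypotheses (htheta : eigenvalues_of (normlap R G1) theta)
  (hmu : eigenvalues_of (normlap R G2) mu)
  (heta : eigenvalues_of (normlap R G3) eta).
Let m1 := #|edges G1|.
Local Notation x := (ratX R).

Let hm1 : #|{: edge G1}| = m1. Proof. by rewrite card_sig. Qed.

Let z0 : x - 1 != 0.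
Proof. by rewrite -(rmorph1 (ratC_morph R)) ratX_sub_neq0. Qed.

Let kE : r3%:R + 1 = 1 + r3%:R :> ratfun R. Proof. by rewrite addrC. Qed.

Let k0 : r3%:R + 1 != 0 :> ratfun R.
Proof. by rewrite natr1 natF_neq0. Qed.

Let pK0 : x - 1 / (r3%:R + 1) != 0.
Proof.
rewrite natr1 -(rmorph1 (ratC_morph R)) -!(rmorph_nat (ratC_morph R)).
by rewrite -fmorph_div ratX_sub_neq0.
Qed.

Lemma char_poly_vertex_corona :
  tofrac (char_poly (normlap R (vertex_corona G1 G2 G3))) =
    (x - 1 - n3%:R / ((r3%:R + 1) * (2 * n2%:R + n3%:R + 2)
                      * (x - 1 / (r3%:R + 1)))) ^ (m1%:Z - n1%:Z)
    * (\prod_(j < n2)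
         (x - (r1%:R + r2%:R * ratC (mu j)) / (r1%:R + r2%:R)) ^+ n1)
    * (\prod_(k < n3)
         (x - (1 + r3%:R * ratC (eta k)) / (r3%:R + 1)) ^+ m1)
    * (\prod_(i < n1)
         ((x - 1) * (x - 1 - n3%:R / ((r3%:R + 1) * (2 * n2%:R + n3%:R + 2)
                                      * (x - 1 / (r3%:R + 1))))
          - ((2 - ratC (theta i))
             * ((r1%:R + r2%:R + n2%:R * r1%:R) * x - (1 + n2%:R) * r1%:R))
            / ((r1%:R + r2%:R) * (2 * n2%:R + n3%:R + 2)
               * (x - r1%:R / (r1%:R + r2%:R))))).
Proof.
have h0 : r1%:R + r2%:R != 0 :> ratfun R.
  by rewrite -natrD natF_neq0 // addn_gt0 r1_gt0.
have r0 : r1%:R != 0 :> ratfun R by rewrite natF_neq0.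
have d0 : 2 * n2%:R + n3%:R + 2 != 0 :> ratfun R.
  by rewrite -natrM -!natrD natF_neq0 // addn_gt0 orbT.
have hE : r1%:R + r2%:R = r1%:R + r2%:R :> ratfun R by [].
have pH0 : x - r1%:R / (r1%:R + r2%:R) != 0.
  by rewrite -natrD -!(rmorph_nat (ratC_morph R)) -fmorph_div ratX_sub_neq0.
move bE: (x - 1 - n3%:R / _) => b.
have b0 : b != 0.
  rewrite -bE natr1 -natrM -!natrD.
  by rewrite pole_perturbation_neq0 // addn_gt0 orbT.
rewrite char_poly_normlap; last first.
  move=> u; rewrite deg_vertex_corona.
  by case: u => [[v|e]|[u|u]] //; rewrite ?addn_gt0 ?r1_gt0 ?orbT.
rewrite (@det_corona _ _ _ _ _ _ _ _ _ _ r2 r3 (r1%:R + r2%:R) (r3%:R + 1)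
  reg2 reg3); last 4 first.
- by move=> u; rewrite deg_vertex_corona natrD.
- by move=> u; rewrite deg_vertex_corona -natr1.
- rewrite (copy_pole _ hE h0); exact: pH0.
- rewrite (copy_pole _ kE k0); exact: pK0.
rewrite (copy_pole _ hE h0) (copy_pole _ kE k0).
rewrite (det_walkmx_regular _ _ reg2 hmu) (det_walkmx_regular _ _ reg3 heta).
under eq_bigr do rewrite (copy_factor _ _ hE h0).
under [X in _ * (_ * X ^+ _)]eq_bigr do rewrite (copy_factor _ _ kE k0).
rewrite hn1 hn2 hn3 hm1 -!prodrXl.
rewrite (@det_schur_vertex_corona _ _ b _ _ z0 b0) -/m1; last first.
  rewrite -bE 2!natrD natrM hn2 hn3; congr (_ - _).
  exact: divf_mulAC.
rewrite (det_incidence _ _ reg1 htheta) hn1 hn2 hn3 2!natrD natrM.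
rewrite -[in _ ^+ n1](card_ord n1) -prodr_const -big_split /=.
under eq_bigr do rewrite (vertex_corona_factor _ _ _ h0 r0 d0 z0 pH0).
by rewrite mulrAC -!mulrA.
Qed.

Lemma char_poly_edge_corona :
  tofrac (char_poly (normlap R (edge_corona G1 G2 G3))) =
    (x - 1) ^ (m1%:Z - n1%:Z)
    * (\prod_(j < n2)
         (x - (2 + r2%:R * ratC (mu j)) / (r2%:R + 2)) ^+ m1)
    * (\prod_(k < n3)
         (x - (1 + r3%:R * ratC (eta k)) / (r3%:R + 1)) ^+ n1)
    * (\prod_(i < n1)
         ((x - 1) * (x - 1 - n3%:R / ((r3%:R + 1)
                                      * (r1%:R * n2%:R + n3%:R + r1%:R)
                                      * (x - 1 / (r3%:R + 1))))
          - (r1%:R * (2 - ratC (theta i))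
             * ((2 * n2%:R + r2%:R + 2) * x - 2 * n2%:R - 2))
            / (2 * (r2%:R + 2) * (r1%:R * n2%:R + n3%:R + r1%:R)
               * (x - 2 / (r2%:R + 2))))).
Proof.
have two0 : 2 != 0 :> ratfun R by exact: natF_neq0.
have h0 : r2%:R + 2 != 0 :> ratfun R.
  by rewrite -natrD natF_neq0 // addn_gt0 orbT.
have d0 : r1%:R * n2%:R + n3%:R + r1%:R != 0 :> ratfun R.
  by rewrite -natrM -!natrD natF_neq0 // addn_gt0 r1_gt0 orbT.
have hE : r2%:R + 2 = 2 + r2%:R :> ratfun R by rewrite addrC.
have pH0 : x - 2 / (r2%:R + 2) != 0.
  by rewrite -natrD -!(rmorph_nat (ratC_morph R)) -fmorph_div ratX_sub_neq0.
move bE: (x - 1 - n3%:R / _) => b.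
rewrite char_poly_normlap; last first.
  move=> u; rewrite deg_edge_corona.
  by case: u => [[v|e]|[u|u]] //; rewrite ?addn_gt0 ?r1_gt0 ?orbT.
rewrite (@det_corona _ _ _ _ _ _ _ _ _ _ r2 r3 (r2%:R + 2) (r3%:R + 1)
  reg2 reg3); last 4 first.
- by move=> u; rewrite deg_edge_corona natrD.
- by move=> u; rewrite deg_edge_corona -natr1.
- rewrite (copy_pole _ hE h0); exact: pH0.
- rewrite (copy_pole _ kE k0); exact: pK0.
rewrite (copy_pole _ hE h0) (copy_pole _ kE k0).
rewrite (det_walkmx_regular _ _ reg2 hmu) (det_walkmx_regular _ _ reg3 heta).
under eq_bigr do rewrite (copy_factor _ _ hE h0).
under [X in _ * (_ * X ^+ _)]eq_bigr do rewrite (copy_factor _ _ kE k0).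
rewrite hn1 hn2 hn3 hm1 -!prodrXl.
rewrite (@det_schur_edge_corona _ _ b _ _ z0) -/m1; last first.
  rewrite -bE 2!natrD natrM hn2 hn3; congr (_ - _).
  exact: divf_mulAC.
rewrite (det_incidence _ _ reg1 htheta) hn1 hn2 hn3 2!natrD natrM.
rewrite -[in _ ^+ n1](card_ord n1) -prodr_const -big_split /=.
under eq_bigr do rewrite (edge_corona_factor _ _ _ _ h0 two0 d0 z0 pH0).
by rewrite mulrAC -!mulrA.
Qed.

End TwoCoronas.

Unset Implicit Arguments.
Set Strict Implicit.
Set Printing Implicit Defensive.

Theorem theorem3p2 (R : rcfType) (G1 G2 G3 : sgraph)
    (n1 n2 n3 m1 m2 m3 r1 r2 r3 : nat)
    (hn1 : #|G1| = n1) (hn2 : #|G2| = n2) (hn3 : #|G3| = n3)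
    (hm1 : #|edges G1| = m1) (hm2 : #|edges G2| = m2) (hm3 : #|edges G3| = m3)
    (hr1 : regular G1 r1) (hr2 : regular G2 r2) (hr3 : regular G3 r3)
    (n1_gt0 : (1 <= n1)%N) (n2_gt0 : (1 <= n2)%N) (n3_gt0 : (1 <= n3)%N)
    (r1_gt0 : (1 <= r1)%N)
    (theta : 'I_n1 -> R) (mu : 'I_n2 -> R) (eta : 'I_n3 -> R)
    (htheta : eigenvalues_of (normlap R G1) theta)
    (hmu : eigenvalues_of (normlap R G2) mu)
    (heta : eigenvalues_of (normlap R G3) eta) :
  let x : ratfun R := ratX R in
  tofrac (char_poly (normlap R (vertex_corona G1 G2 G3))) =
    (x - 1 - n3%:R / ((r3%:R + 1) * (2 * n2%:R + n3%:R + 2)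
                      * (x - 1 / (r3%:R + 1)))) ^ (m1%:Z - n1%:Z)
    * (\prod_(j < n2)
         (x - (r1%:R + r2%:R * ratC (mu j)) / (r1%:R + r2%:R)) ^+ n1)
    * (\prod_(k < n3)
         (x - (1 + r3%:R * ratC (eta k)) / (r3%:R + 1)) ^+ m1)
    * (\prod_(i < n1)
         ((x - 1) * (x - 1 - n3%:R / ((r3%:R + 1) * (2 * n2%:R + n3%:R + 2)
                                      * (x - 1 / (r3%:R + 1))))
          - ((2 - ratC (theta i))
             * ((r1%:R + r2%:R + n2%:R * r1%:R) * x - (1 + n2%:R) * r1%:R))
            / ((r1%:R + r2%:R) * (2 * n2%:R + n3%:R + 2)
               * (x - r1%:R / (r1%:R + r2%:R)))))
  /\
  tofrac (char_poly (normlap R (edge_corona G1 G2 G3))) =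
    (x - 1) ^ (m1%:Z - n1%:Z)
    * (\prod_(j < n2)
         (x - (2 + r2%:R * ratC (mu j)) / (r2%:R + 2)) ^+ m1)
    * (\prod_(k < n3)
         (x - (1 + r3%:R * ratC (eta k)) / (r3%:R + 1)) ^+ n1)
    * (\prod_(i < n1)
         ((x - 1) * (x - 1 - n3%:R / ((r3%:R + 1)
                                      * (r1%:R * n2%:R + n3%:R + r1%:R)
                                      * (x - 1 / (r3%:R + 1))))
          - (r1%:R * (2 - ratC (theta i))
             * ((2 * n2%:R + r2%:R + 2) * x - 2 * n2%:R - 2))
            / (2 * (r2%:R + 2) * (r1%:R * n2%:R + n3%:R + r1%:R)
               * (x - 2 / (r2%:R + 2))))).

Proof.
subst m1; split.
  exact: (char_poly_vertex_corona hr1 hr2 hr3).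
exact: (char_poly_edge_corona hr1 hr2 hr3).
Qed.
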